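(* Let $\sigma\subset\mathbb{R}^2$ be a circular arc of radius $1$ and of arc length less than $1.32$, and let $\sigma'$ be any image of $\sigma$ under an isometry of the plane. Then for every $\varepsilon>0$ there is a continuous motion $(g_t)_{t\in[0,1]}$ with $g_0=\mathrm{id}$ and $g_1(\sigma)=\sigma'$ such that the set $\bigcup_{t\in[0,1]} g_t(\sigma)$ of points touched by the moving arc has Lebesgue measure less than $\varepsilon$.
   Context: A continuous motion is a continuous map $t\mapsto g_t$ from $[0,1]$ into the group of orientation-preserving isometries of $\mathbb{R}^2$ (with its natural topology). The area of a set is its (two-dimensional) Lebesgue measure. *)

(* Defs.v *)
From Stdlib Require Import Reals Lra.
Open Scope R_scope.

Definition point : Type := (R * R)%type.

Definition dist2 (p q : point) : R :=
  sqrt ((fst p - fst q)^2 + (snd p - snd q)^2).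

Definition isometry (f : point -> point) : Prop :=
  forall p q, dist2 (f p) (f q) = dist2 p q.

Definition image (f : point -> point) (S : point -> Prop) : point -> Prop :=
  fun p => exists q, S q /\ f q = p.

Definition unit_arc (cx cy alpha L : R) : point -> Prop :=
  fun p => exists u, alpha <= u <= alpha + L /\
                     p = (cx + cos u, cy + sin u).

Definition continuous_on_01 (f : R -> R) : Prop :=
  forall t, 0 <= t <= 1 -> forall eps, eps > 0 ->
    exists delta, delta > 0 /\
      forall t', 0 <= t' <= 1 -> Rabs (t' - t) < delta ->
        Rabs (f t' - f t) < eps.

(* An orientation-preserving isometry of R^2, given by a rotation matrix
   [[c,-s],[s,c]] (c^2+s^2=1) followed by translation by (a,b). *)
Definition rigid (c s a b : R) (p : point) : point :=
  (c * fst p - s * snd p + a, s * fst p + c * snd p + b).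

(* A continuous motion t |-> g_t, t in [0,1], into the group SE(2) with its
   natural (Lie group) topology, SE(2) = SO(2) x R^2 as a space. *)
Record motion : Type := Motion {
  mc : R -> R; ms : R -> R; ma : R -> R; mb : R -> R;
  m_rot : forall t, 0 <= t <= 1 -> mc t ^ 2 + ms t ^ 2 = 1;
  m_cc : continuous_on_01 mc;
  m_cs : continuous_on_01 ms;
  m_ca : continuous_on_01 ma;
  m_cb : continuous_on_01 mb
}.

Definition mapp (g : motion) (t : R) : point -> point :=
  rigid (mc g t) (ms g t) (ma g t) (mb g t).

Definition swept (g : motion) (S : point -> Prop) : point -> Prop :=
  fun p => exists t, 0 <= t <= 1 /\ image (mapp g t) S p.

(* Lebesgue (outer) measure of S is < eps: S is covered by countably many
   closed axis-parallel rectangles of total area < eps.  (This is exactly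
   "inf over such covers < eps", i.e. the Lebesgue outer measure is < eps;
   for measurable S this is the Lebesgue measure.) *)
Definition measure_lt (S : point -> Prop) (eps : R) : Prop :=
  exists (x1 x2 y1 y2 : nat -> R) (delta : R),
    delta < eps /\
    (forall n, x1 n <= x2 n /\ y1 n <= y2 n) /\
    (forall p, S p -> exists n,
        x1 n <= fst p <= x2 n /\ y1 n <= snd p <= y2 n) /\
    (forall N, sum_f_R0 (fun n => (x2 n - x1 n) * (y2 n - y1 n)) N <= delta).

(* Main.v *)
(** Rotating the arc about its own centre is free, so only the displacement of
    the centre costs area, and the arc may be turned arbitrarily before each
    displacement.  Suppose displacements of length [rho] can be made at cost
    [kappa * rho].  A displacement in direction [phi] is decomposed into a
    displacement in direction [Om := phi + 3/2] and one in the perpendicular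
    direction [Om - PI/2], the latter of length [rho * sin (3/2)].  The
    decomposition is made in many small stages, the direction turning by a small
    angle [d] at each stage, and each stage is implemented by arbitrarily fine
    zigzags, so that the centre always stays close to the segments of all earlier
    stages.  The displacements in direction [Om] are performed with the arc whose
    normals range over [phi + PI/2, Om + PI/2]: each of its points is then almost
    tangent to the segment of some stage, and is swept inside a thin neighbourhood
    of it, so that altogether this costs only [O(d)].  Hence the cost drops to
    [kappa * sin (3/2) * rho], and iterating makes it arbitrarily small. *)

Require Import Defs.
From Stdlib Require Import Reals Lra Lia ZArith List FunctionalExtensionality.
From Coquelicot Require Import Rcomplements.
Open Scope R_scope.

(** * Finite covers by axis-parallel rectangles *)

Record rect : Type := Rect { rx1 : R; rx2 : R; ry1 : R; ry2 : R }.

Definition rect_valid (r : rect) : Prop := rx1 r <= rx2 r /\ ry1 r <= ry2 r.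

Definition rect_mem (p : point) (r : rect) : Prop :=
  rx1 r <= fst p <= rx2 r /\ ry1 r <= snd p <= ry2 r.

Definition rect_area (r : rect) : R := (rx2 r - rx1 r) * (ry2 r - ry1 r).

Definition total_area (l : list rect) : R :=
  fold_right (fun r s => rect_area r + s) 0 l.

Definition cover (S : point -> Prop) (m : R) : Prop :=
  exists l : list rect, Forall rect_valid l /\
    (forall p, S p -> Exists (rect_mem p) l) /\ total_area l <= m.

Lemma total_area_app l1 l2 :
  total_area (l1 ++ l2) = total_area l1 + total_area l2.
Proof.
  unfold total_area; induction l1 as [|r l IH]; simpl; [ring|].
  rewrite IH; ring.
Qed.

Lemma cover_sub (S S' : point -> Prop) m m' :
  (forall p, S' p -> S p) -> m <= m' -> cover S m -> cover S' m'.
Proof.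
  intros H Hm [l (Hv & Hc & Ha)]; exists l; repeat split; auto; lra.
Qed.

Lemma cover_union (S1 S2 : point -> Prop) m1 m2 :
  cover S1 m1 -> cover S2 m2 -> cover (fun p => S1 p \/ S2 p) (m1 + m2).
Proof.
  intros [l1 (V1 & C1 & A1)] [l2 (V2 & C2 & A2)].
  exists (l1 ++ l2); repeat split.
  - apply Forall_app; auto.
  - intros p Hp; apply Exists_app; destruct Hp; auto.
  - rewrite total_area_app; lra.
Qed.

Lemma cover_empty (S : point -> Prop) : (forall p, ~ S p) -> cover S 0.
Proof.
  intros H; exists nil; repeat split; auto.
  - intros p Hp; destruct (H p Hp).
  - simpl; lra.
Qed.

Lemma cover_iunion (S : nat -> point -> Prop) c m :
  (forall i, (i < m)%nat -> cover (S i) c) ->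
  cover (fun p => exists i, (i < m)%nat /\ S i p) (INR m * c).
Proof.
  induction m as [|m IH]; intros H.
  - simpl INR; rewrite Rmult_0_l.
    apply cover_empty; intros p [i [Hi _]]; lia.
  - rewrite S_INR, Rmult_plus_distr_r, Rmult_1_l.
    apply (cover_sub (fun p => (exists i, (i < m)%nat /\ S i p) \/ S m p)
             _ (INR m * c + c)); [|lra|].
    + intros p [i [Hi Hp]]; destruct (Nat.eq_dec i m) as [->|Hn]; [now right|].
      left; exists i; split; [lia|auto].
    + apply cover_union; [apply IH; auto with arith|apply H; lia].
Qed.

Lemma cover_square a b h :
  0 <= h ->
  cover (fun p => Rabs (fst p - a) <= h /\ Rabs (snd p - b) <= h) (4 * h ^ 2).
Proof.
  intros Hh; exists (Rect (a - h) (a + h) (b - h) (b + h) :: nil); split; [|split].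
  - constructor; [split; simpl; lra|constructor].
  - intros p [H1 H2]; apply Exists_cons_hd.
    apply Rabs_le_between in H1, H2; split; simpl; lra.
  - unfold total_area, rect_area; simpl; lra.
Qed.

(** Padding the list with a degenerate rectangle of area [0] gives the sequences that [measure_lt]
    asks for. *)
Lemma measure_lt_cover (S : point -> Prop) m eps :
  cover S m -> m < eps -> measure_lt S eps.
Proof.
  intros [l (V & C & A)] Hm.
  pose (d := Rect 0 0 0 0).
  exists (fun n => rx1 (nth n l d)), (fun n => rx2 (nth n l d)),
    (fun n => ry1 (nth n l d)), (fun n => ry2 (nth n l d)), m.
  split; [exact Hm|]; split; [|split].
  - intros n; destruct (nth_in_or_default n l d) as [Hin| ->].
    + exact (proj1 (Forall_forall _ _) V _ Hin).
    + simpl; lra.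
  - intros p Hp; apply C, Exists_nth in Hp as (n & d' & Hn & Hr).
    exists n; rewrite (nth_indep l d d' Hn); exact Hr.
  - intros N; apply Rle_trans with (2 := A); clear C A Hm m.
    (* Bounds the partial sums that stop before the end of the list. *)
    assert (Hpos : forall l', Forall rect_valid l' -> 0 <= total_area l').
    { induction l' as [|r l' IH]; simpl; intros H; [lra|].
      inversion H as [|? ? [H1 H2] H3]; subst.
      specialize (IH H3).
      assert (0 <= rect_area r) by (apply Rmult_le_pos; lra); lra. }
    revert N; induction l as [|r l IH]; intros N.
    + rewrite (sum_eq _ (fun _ => 0)).
      * rewrite sum_cte; simpl; lra.
      * intros [|i] _; simpl; ring.
    + inversion V as [|? ? V1 V2]; subst; specialize (Hpos l V2).
      destruct N as [|N].
      * simpl; unfold rect_area; lra.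
      * rewrite decomp_sum by lia; simpl pred.
        specialize (IH V2 N); simpl in IH |- *; unfold rect_area at 1; lra.
Qed.

(** * Covers of thickened curves *)

Lemma cell_index m mu v :
  (0 < m)%nat -> 0 <= v <= INR m * mu ->
  exists i, (i < m)%nat /\ INR i * mu <= v <= INR i * mu + mu.
Proof.
  induction m as [|m IH]; intros Hm Hv; [lia|].
  rewrite S_INR in Hv.
  destruct (Rle_lt_dec (INR m * mu) v) as [H|H].
  - exists m; split; [lia|lra].
  - destruct (Nat.eq_dec m 0) as [->|Hm0]; [simpl in *; lra|].
    destruct IH as [i [Hi Hv']]; [lia|lra|].
    exists i; split; [lia|exact Hv'].
Qed.

Definition lip1 (g : R -> R) : Prop := forall u v, Rabs (g u - g v) <= Rabs (u - v).

(** One square per cell suffices, since on a cell both coordinates vary by at most its length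
    [(B - A) / INR m]. With [h = 0] the total tends to [0] as [m] grows. *)
Lemma cover_curve (gx gy : R -> R) A B h m :
  lip1 gx -> lip1 gy -> A <= B -> 0 <= h -> (0 < m)%nat ->
  cover (fun p => exists u, A <= u <= B /\
           Rabs (fst p - gx u) <= h /\ Rabs (snd p - gy u) <= h)
    (INR m * (4 * (h + (B - A) / INR m) ^ 2)).
Proof.
  intros Lx Ly HAB Hh Hm.
  assert (Hm' : 0 < INR m) by (apply lt_0_INR; lia).
  set (mu := (B - A) / INR m).
  assert (Hmu : INR m * mu = B - A) by (unfold mu; field; lra).
  assert (Hmu0 : 0 <= mu) by (apply Rdiv_le_0_compat; lra).
  eapply cover_sub; [|apply Rle_refl|apply (cover_iunion (fun i p =>
    Rabs (fst p - gx (A + INR i * mu)) <= h + mu /\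
    Rabs (snd p - gy (A + INR i * mu)) <= h + mu))].
  - intros p (u & Hu & H1 & H2).
    destruct (cell_index m mu (u - A)) as [i [Hi Hv]]; [exact Hm|lra|].
    exists i; split; [exact Hi|].
    assert (Hd : Rabs (u - (A + INR i * mu)) <= mu) by (apply Rabs_le; lra).
    pose proof (Lx u (A + INR i * mu)); pose proof (Ly u (A + INR i * mu)).
    pose proof (Rabs_triang (fst p - gx u) (gx u - gx (A + INR i * mu))).
    pose proof (Rabs_triang (snd p - gy u) (gy u - gy (A + INR i * mu))).
    replace (fst p - gx (A + INR i * mu)) with
      (fst p - gx u + (gx u - gx (A + INR i * mu))) by ring.
    replace (snd p - gy (A + INR i * mu)) with
      (snd p - gy u + (gy u - gy (A + INR i * mu))) by ring.
    lra.
  - intros i Hi; apply cover_square; lra.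
Qed.

(** * Lipschitz bounds for sine and cosine *)

Lemma Rabs_sin_le x : Rabs (sin x) <= Rabs x.
Proof.
  assert (H : forall y, 0 < y -> Rabs (sin y) <= y).
  { intros y Hy; apply Rabs_le; split; [|left; now apply sin_lt_x].
    destruct (Rle_lt_dec y PI) as [H1|H1].
    - pose proof (sin_ge_0 y (Rlt_le _ _ Hy) H1); lra.
    - pose proof (SIN_bound y); pose proof PI2_3_2; lra. }
  destruct (Rtotal_order x 0) as [Hx|[->|Hx]].
  - rewrite <- (Rabs_Ropp x), <- Rabs_Ropp, <- sin_neg.
    rewrite (Rabs_right (- x)) by lra; apply H; lra.
  - rewrite sin_0; lra.
  - rewrite (Rabs_right x) by lra; now apply H.
Qed.

(** The sine factor is kept because it is small near [0]: there cosine varies only to second order,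
    whence the square in [cover_tube]. *)
Lemma Rabs_cos_minus_le p q :
  Rabs (cos p - cos q) <= Rabs (p - q) * Rabs (sin ((p + q) / 2)).
Proof.
  rewrite form2, !Rabs_mult, (Rabs_left (-2)) by lra.
  pose proof (Rabs_sin_le ((p - q) / 2)) as H.
  unfold Rdiv at 2 in H; rewrite Rabs_mult, (Rabs_right (/ 2)) in H by lra.
  apply Rmult_le_compat_r; [apply Rabs_pos|lra].
Qed.

Lemma cos_lip1 : lip1 cos.
Proof.
  intros p q; pose proof (Rabs_cos_minus_le p q) as H.
  assert (H1 : Rabs (sin ((p + q) / 2)) <= 1)
    by (apply Rabs_le, SIN_bound).
  pose proof (Rabs_pos (p - q)); nra.
Qed.

Lemma sin_lip1 : lip1 sin.
Proof.
  intros p q; rewrite <- (cos_shift p), <- (cos_shift q).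
  replace (Rabs (p - q)) with (Rabs ((PI / 2 - p) - (PI / 2 - q))).
  - apply cos_lip1.
  - rewrite <- Rabs_Ropp; f_equal; ring.
Qed.

Lemma Rabs_le_of_bound x b : -1 <= x <= 1 -> Rabs (x * b) <= Rabs b.
Proof.
  intros Hx; rewrite Rabs_mult.
  assert (Rabs x <= 1) by (now apply Rabs_le).
  pose proof (Rabs_pos b); nra.
Qed.

Lemma Rabs_le_mult_bound x b h : -1 <= x <= 1 -> Rabs b <= h -> Rabs (x * b) <= h.
Proof. intros H1 H2; pose proof (Rabs_le_of_bound x b H1); lra. Qed.

Lemma exists_nat_pos_ge (x : R) : exists m, (0 < m)%nat /\ x <= INR m.
Proof.
  destruct (INR_unbounded x) as [n Hn].
  exists (S n); split; [lia|rewrite S_INR; lra].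
Qed.

Lemma exists_nat_ceil (x : R) : 0 <= x -> exists m, (0 < m)%nat /\ x <= INR m <= x + 1.
Proof.
  intros Hx.
  destruct (archimed x) as [H1 H2].
  assert (0 < IZR (up x)) by lra.
  assert (0 < up x)%Z by (now apply lt_IZR).
  exists (Z.to_nat (up x)); split; [lia|].
  rewrite INR_IZR_INZ, Z2Nat.id by lia; lra.
Qed.

(** * Tilted rectangles and thin tubes *)

(** At most [A / B + 1] squares of half-side at most [2 * B], strung along the long side, have total
    area at most [16 * B * (A + B)]. *)
Lemma cover_tilted_rect cx cy phi y0 z0 A B :
  0 < B <= A ->
  cover (fun p => exists y z, y0 <= y <= y0 + A /\ z0 <= z <= z0 + B /\
           p = (cx + y * cos phi - z * sin phi, cy + y * sin phi + z * cos phi))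
    (32 * (A * B)).
Proof.
  intros [HB HAB].
  destruct (exists_nat_ceil (A / B)) as [m [Hm [Hm1 Hm2]]];
    [apply Rdiv_le_0_compat; lra|].
  assert (Hm' : 0 < INR m) by (apply lt_0_INR; lia).
  assert (HAm : A <= INR m * B).
  { apply (Rmult_le_compat_r B) in Hm1; [|lra].
    unfold Rdiv in Hm1; rewrite Rmult_assoc, Rinv_l in Hm1 by lra; lra. }
  assert (HmB : INR m * B <= A + B).
  { apply (Rmult_le_compat_r B) in Hm2; [|lra].
    unfold Rdiv in Hm2; rewrite Rmult_plus_distr_r, Rmult_assoc, Rinv_l in Hm2 by lra; lra. }
  pose proof (COS_bound phi) as Hc; pose proof (SIN_bound phi) as Hs.
  eapply cover_sub; [| |
    apply (cover_curve (fun y => cx + y * cos phi - z0 * sin phi)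
             (fun y => cy + y * sin phi + z0 * cos phi) y0 (y0 + A) B m)];
    try lra; try lia.
  - intros p (y & z & Hy & Hz & ->); exists y; simpl; split; [exact Hy|].
    assert (Hd : Rabs (z - z0) <= B) by (apply Rabs_le; lra).
    split.
    + replace (_ - _) with (- sin phi * (z - z0)) by ring.
      apply Rabs_le_mult_bound; lra.
    + replace (_ - _) with (cos phi * (z - z0)) by ring.
      apply Rabs_le_mult_bound; lra.
  - set (q := (y0 + A - y0) / INR m).
    assert (Hq : 0 <= q <= B).
    { unfold q; split; [apply Rdiv_le_0_compat; lra|].
      apply Rle_div_l; lra. }
    assert (INR m * (4 * (B + q) ^ 2) <= INR m * (16 * B ^ 2)).
    { apply Rmult_le_compat_l; [lra|]; nra. }
    nra.
  - intros u v; replace (_ - _) with (cos phi * (u - v)) by ring.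
    now apply Rabs_le_of_bound.
  - intros u v; replace (_ - _) with (sin phi * (u - v)) by ring.
    now apply Rabs_le_of_bound.
Qed.

(* The centre stays near a segment of length [ell] whose direction is almost
   tangent to the part of the arc in question, which makes the area
   proportional to [delta ^ 2] instead of [delta]. *)
Lemma cover_tube ell delta :
  0 < ell -> 0 < delta <= 1 ->
  exists eps, 0 < eps /\ forall cx cy phi,
    cover (fun p => exists x y s u,
             0 <= s <= 1 /\
             Rabs (x - (cx + s * (ell * cos phi))) <= eps /\
             Rabs (y - (cy + s * (ell * sin phi))) <= eps /\
             phi + PI / 2 <= u <= phi + PI / 2 + delta /\
             p = (x + cos u, y + sin u))
      (384 * (ell * delta ^ 2)).
Proof.
  intros Hl Hd.
  destruct (exists_nat_pos_ge (delta / ell)) as [m [Hm Hm1]].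
  assert (Hm' : 0 < INR m) by (apply lt_0_INR; lia).
  set (mu := delta / INR m).
  assert (Hmu : INR m * mu = delta) by (unfold mu; field; lra).
  assert (Hmu0 : 0 < mu) by (apply Rdiv_lt_0_compat; lra).
  assert (Hmul : mu <= ell).
  { apply Rle_div_l; [lra|]. apply Rle_div_l in Hm1; lra. }
  assert (Hmd : 0 < mu * delta <= mu) by (split; [apply Rmult_lt_0_compat; lra|nra]).
  (* An error [eps] in [x] and [y] shifts the coordinates along and across [phi] by at most
     [2 * eps = mu * delta / 2]. *)
  exists (mu * delta / 4); split; [lra|]; intros cx cy phi.
  (* In axes along and across [phi], the points of cell [i] spread over a length
     [ell + 2 * mu + mu * delta <= 4 * ell] and a width [2 * (mu * delta)] from the cosine plus
     [mu * delta] from the error. *)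
  eapply cover_sub with (m := INR m * (32 * ((4 * ell) * (3 * (mu * delta)))));
    [| |apply (cover_iunion (fun i p => exists y z,
        - sin (INR i * mu) - mu - mu * delta / 2 <= y
          <= - sin (INR i * mu) - mu - mu * delta / 2 + 4 * ell /\
        cos (INR i * mu) - mu * delta - mu * delta / 2 <= z
          <= cos (INR i * mu) - mu * delta - mu * delta / 2 + 3 * (mu * delta) /\
        p = (cx + y * cos phi - z * sin phi, cy + y * sin phi + z * cos phi)))].
  - intros p (x & y & s & u & Hs & Hx & Hy & Hu & ->).
    (* [v] is the angle from the normal to the segment; being at most [delta], it makes the sine
       factor below at most [delta]. *)
    set (v := u - phi - PI / 2).
    assert (Hv : 0 <= v <= delta) by (unfold v; lra).
    destruct (cell_index m mu v) as [i [Hi Hiv]]; [exact Hm|lra|].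
    exists i; split; [exact Hi|].
    assert (Hi0 : 0 <= INR i * mu) by (apply Rmult_le_pos; [apply pos_INR|lra]).
    assert (Hdv : Rabs (v - INR i * mu) <= mu) by (apply Rabs_le; lra).
    pose proof (sin_lip1 v (INR i * mu)) as Hsin.
    assert (Hcos : Rabs (cos v - cos (INR i * mu)) <= mu * delta).
    { eapply Rle_trans; [apply Rabs_cos_minus_le|].
      apply Rmult_le_compat; try apply Rabs_pos; [exact Hdv|].
      eapply Rle_trans; [apply Rabs_sin_le|].
      apply Rabs_le; lra. }
    set (ex := x - (cx + s * (ell * cos phi))) in *.
    set (ey := y - (cy + s * (ell * sin phi))) in *.
    pose proof (COS_bound phi) as Hc; pose proof (SIN_bound phi) as Hsn.
    pose proof (Rabs_le_mult_bound _ _ _ Hc Hx) as E1.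
    pose proof (Rabs_le_mult_bound _ _ _ Hsn Hx) as E2.
    pose proof (Rabs_le_mult_bound _ _ _ Hc Hy) as E3.
    pose proof (Rabs_le_mult_bound _ _ _ Hsn Hy) as E4.
    assert (Hsin' : Rabs (sin v - sin (INR i * mu)) <= mu) by lra.
    apply Rabs_le_between in E1, E2, E3, E4, Hsin', Hcos.
    exists (s * ell - sin v + (cos phi * ex + sin phi * ey)),
      (cos v + (cos phi * ey - sin phi * ex)).
    assert (0 <= s * ell <= ell) by (split; nra).
    split; [lra|split; [lra|]].
    replace u with (v + phi + PI / 2) by (unfold v; ring).
    rewrite !cos_plus, !sin_plus, cos_PI2, sin_PI2, !cos_plus.
    assert (Hcs : cos phi * cos phi = 1 - sin phi * sin phi)
      by (pose proof (sin2_cos2 phi); unfold Rsqr in *; lra).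
    assert (Ex : x = ex + cx + s * (ell * cos phi)) by (unfold ex; ring).
    assert (Ey : y = ey + cy + s * (ell * sin phi)) by (unfold ey; ring).
    clearbody ex ey v; subst x y; f_equal.
    + transitivity (cx + (s * ell - sin v) * cos phi - cos v * sin phi
        + ex * (cos phi * cos phi + sin phi * sin phi)); [rewrite Hcs|]; ring.
    + transitivity (cy + (s * ell - sin v) * sin phi + cos v * cos phi
        + ey * (cos phi * cos phi + sin phi * sin phi)); [rewrite Hcs|]; ring.
  - right; transitivity (384 * (ell * delta * (INR m * mu))); [ring|rewrite Hmu; ring].
  - intros i Hi.
    apply cover_tilted_rect; lra.
Qed.

(** * Paths of states and their concatenation *)

(* A state consists of the centre of the circle and the starting angle of the
   arc, the latter as a real number and not modulo [2 * PI]. *)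
Definition reach (x0 y0 t0 x1 y1 t1 : R) (S : R -> R -> R -> Prop) : Prop :=
  exists fx fy ft : R -> R,
    (continuity fx /\ continuity fy /\ continuity ft) /\
    (fx 0 = x0 /\ fy 0 = y0 /\ ft 0 = t0) /\
    (fx 1 = x1 /\ fy 1 = y1 /\ ft 1 = t1) /\
    (forall t, 0 <= t <= 1 -> S (fx t) (fy t) (ft t)).

Lemma continuity_affine a b : continuity (fun t => a + t * b).
Proof. apply derivable_continuous; reg. Qed.

Lemma reach_line x0 y0 t0 dx dy dt (S : R -> R -> R -> Prop) :
  (forall s, 0 <= s <= 1 -> S (x0 + s * dx) (y0 + s * dy) (t0 + s * dt)) ->
  reach x0 y0 t0 (x0 + dx) (y0 + dy) (t0 + dt) S.
Proof.
  intros H.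
  exists (fun s => x0 + s * dx), (fun s => y0 + s * dy), (fun s => t0 + s * dt).
  split; [repeat split; apply continuity_affine|].
  split; [repeat split; ring|]; split; [repeat split; ring|exact H].
Qed.

(* [first_half] and [second_half] run through [0, 1] one after the other, so
   two paths sharing an endpoint [b] are concatenated by the single formula
   [f (first_half t) + g (second_half t) - b]. *)
Definition first_half (t : R) : R := (2 * t + 1 - Rabs (2 * t - 1)) / 2.
Definition second_half (t : R) : R := (2 * t - 1 + Rabs (2 * t - 1)) / 2.

Lemma continuity_halves : continuity first_half /\ continuity second_half.
Proof.
  assert (HA : continuity (fun t => Rabs (2 * t - 1))).
  { apply (continuity_comp (fun t => 2 * t - 1) Rabs).
    - apply derivable_continuous; reg.
    - exact Rcontinuity_abs. }
  assert (H1 : continuity (fun t => (2 * t + 1) / 2))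
    by (apply derivable_continuous; reg).
  assert (H2 : continuity (fun t => (2 * t - 1) / 2))
    by (apply derivable_continuous; reg).
  assert (HB : continuity (fun t => / 2 * Rabs (2 * t - 1)))
    by (apply (continuity_scal (fun t => Rabs (2 * t - 1))); exact HA).
  split.
  - eapply eq_ind with (1 := continuity_minus _ _ H1 HB).
    extensionality t; unfold first_half, minus_fct; field.
  - eapply eq_ind with (1 := continuity_plus _ _ H2 HB).
    extensionality t; unfold second_half, plus_fct; field.
Qed.

Definition glue (f g : R -> R) (t : R) : R :=
  f (first_half t) + g (second_half t) - g 0.

Lemma continuity_glue f g : continuity f -> continuity g -> continuity (glue f g).
Proof.
  intros Hf Hg; destruct continuity_halves as [H1 H2].
  pose proof (continuity_comp _ _ H1 Hf) as C1.
  pose proof (continuity_comp _ _ H2 Hg) as C2.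
  assert (C3 : continuity (fun _ : R => g 0)) by (apply continuity_const; intros ? ?; reflexivity).
  exact (continuity_minus _ _ (continuity_plus _ _ C1 C2) C3).
Qed.

Lemma glue_left f g t : f 1 = g 0 -> t <= 1 / 2 -> glue f g t = f (2 * t).
Proof.
  intros H Ht; unfold glue, first_half, second_half.
  rewrite Rabs_left1 by lra.
  replace ((2 * t + 1 - - (2 * t - 1)) / 2) with (2 * t) by field.
  replace ((2 * t - 1 + - (2 * t - 1)) / 2) with 0 by field; ring.
Qed.

Lemma glue_right f g t : f 1 = g 0 -> 1 / 2 <= t -> glue f g t = g (2 * t - 1).
Proof.
  intros H Ht; unfold glue, first_half, second_half.
  rewrite Rabs_right by lra.
  replace ((2 * t + 1 - (2 * t - 1)) / 2) with 1 by field.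
  replace ((2 * t - 1 + (2 * t - 1)) / 2) with (2 * t - 1) by field; lra.
Qed.

Lemma reach_trans x0 y0 t0 x1 y1 t1 x2 y2 t2 (S1 S2 : R -> R -> R -> Prop) :
  reach x0 y0 t0 x1 y1 t1 S1 -> reach x1 y1 t1 x2 y2 t2 S2 ->
  reach x0 y0 t0 x2 y2 t2 (fun x y t => S1 x y t \/ S2 x y t).
Proof.
  intros (fx & fy & ft & (Cx & Cy & Ct) & (X0 & Y0 & T0) & (X1 & Y1 & T1) & HS1).
  intros (gx & gy & gt & (Dx & Dy & Dt) & (U0 & V0 & W0) & (U1 & V1 & W1) & HS2).
  assert (Ex : fx 1 = gx 0) by congruence.
  assert (Ey : fy 1 = gy 0) by congruence.
  assert (Et : ft 1 = gt 0) by congruence.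
  exists (glue fx gx), (glue fy gy), (glue ft gt).
  split; [repeat split; apply continuity_glue; assumption|].
  split; [rewrite !glue_left by (assumption || lra); rewrite Rmult_0_r; auto|].
  split.
  { rewrite !glue_right by (assumption || lra).
    replace (2 * 1 - 1) with 1 by ring; auto. }
  intros t Ht; destruct (Rle_lt_dec t (1 / 2)) as [H|H].
  - rewrite !glue_left by (assumption || lra); left; apply HS1; lra.
  - rewrite !glue_right by (assumption || lra); right; apply HS2; lra.
Qed.

(** * Moves of the centre and the area they sweep *)

(** [U] selects directions in the plane, not positions along the arc, so that the area can be
    accounted for one range of normals at a time. *)
Definition touched (L : R) (S : R -> R -> R -> Prop) (U : R -> Prop) : point -> Prop :=
  fun p => exists x y th u, S x y th /\ th <= u <= th + L /\ U u /\
             p = (x + cos u, y + sin u).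

Definition near (x y dx dy eps : R) (S : R -> R -> R -> Prop) : Prop :=
  forall x' y' th, S x' y' th -> exists s, 0 <= s <= 1 /\
    Rabs (x' - (x + s * dx)) <= eps /\ Rabs (y' - (y + s * dy)) <= eps.

(* The centre can be displaced by [(dx, dy)], staying [eps]-close to the
   straight segment and returning to angle [0], in such a way that the points of
   the arc with angle in [U] sweep an area at most [m]. *)
Definition move (L : R) (U : R -> Prop) (dx dy eps m : R) : Prop :=
  forall x y, exists S, reach x y 0 (x + dx) (y + dy) 0 S /\
    near x y dx dy eps S /\ cover (touched L S U) m.

Lemma cover_touched_or L S1 S2 U m1 m2 :
  cover (touched L S1 U) m1 -> cover (touched L S2 U) m2 ->
  cover (touched L (fun x y t => S1 x y t \/ S2 x y t) U) (m1 + m2).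
Proof.
  intros H1 H2.
  eapply cover_sub; [|apply Rle_refl|exact (cover_union _ _ _ _ H1 H2)].
  intros p (x & y & th & u & [HS|HS] & Hu & HU & ->); [left|right];
    exists x, y, th, u; auto.
Qed.

Lemma move_weaken L (U U' : R -> Prop) dx dy eps eps' m m' :
  (forall u, U' u -> U u) -> eps <= eps' -> m <= m' ->
  move L U dx dy eps m -> move L U' dx dy eps' m'.
Proof.
  intros HU He Hm H x y; destruct (H x y) as [S (HR & HN & HC)].
  exists S; split; [exact HR|split].
  - intros x' y' th HS; destruct (HN _ _ _ HS) as (s & Hs & H1 & H2).
    exists s; split; [exact Hs|lra].
  - apply (cover_sub (touched L S U) _ m); [|exact Hm|exact HC].
    intros p (x' & y' & th & u & HS & Hu & HUu & Hp).
    exists x', y', th, u; auto.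
Qed.

Lemma Rabs_scaled_le s d r : 0 <= s <= 1 -> Rabs d <= r -> - r <= s * d <= r.
Proof.
  intros Hs Hd; apply Rabs_le_between.
  apply Rabs_le_mult_bound; lra.
Qed.

(** With legs bounded by [r], both legs stay within [eps + 2 * r] of the starting point in each
    coordinate. This crude bound suffices for short legs. *)
Lemma move_seq L U dx1 dy1 dx2 dy2 eps r m1 m2 :
  Rabs dx1 <= r -> Rabs dy1 <= r -> Rabs dx2 <= r -> Rabs dy2 <= r ->
  move L U dx1 dy1 eps m1 -> move L U dx2 dy2 eps m2 ->
  move L U (dx1 + dx2) (dy1 + dy2) (eps + 2 * r) (m1 + m2).
Proof.
  intros B1 B2 B3 B4 H1 H2 x y.
  destruct (H1 x y) as [S1 (R1 & N1 & C1)].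
  destruct (H2 (x + dx1) (y + dy1)) as [S2 (R2 & N2 & C2)].
  exists (fun x y t => S1 x y t \/ S2 x y t); split; [|split].
  - rewrite <- !Rplus_assoc; exact (reach_trans _ _ _ _ _ _ _ _ _ _ _ R1 R2).
  - assert (Hb : forall d, Rabs d <= r -> - r <= d <= r)
      by (intros d Hd; now apply Rabs_le_between).
    intros x' y' th HS; exists 0; split; [lra|].
    destruct HS as [HS|HS].
    + destruct (N1 _ _ _ HS) as (s & Hs & Hx & Hy).
      pose proof (Rabs_scaled_le s dx1 r Hs B1).
      pose proof (Rabs_scaled_le s dy1 r Hs B2).
      apply Rabs_le_between in Hx, Hy.
      split; apply Rabs_le; lra.
    + destruct (N2 _ _ _ HS) as (s & Hs & Hx & Hy).
      pose proof (Rabs_scaled_le s dx2 r Hs B3).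
      pose proof (Rabs_scaled_le s dy2 r Hs B4).
      pose proof (Hb _ B1); pose proof (Hb _ B2).
      apply Rabs_le_between in Hx, Hy.
      split; apply Rabs_le; lra.
  - now apply cover_touched_or.
Qed.

(** The tolerance [eps] does not accumulate: every repetition starts exactly on the long segment,
    and its own segment is part of the long one. *)
Lemma move_iter L U dx dy eps m N :
  (0 < N)%nat -> move L U dx dy eps m ->
  move L U (INR N * dx) (INR N * dy) eps (INR N * m).
Proof.
  intros HN H; induction N as [|N IH]; [lia|].
  destruct (Nat.eq_dec N 0) as [->|HN0].
  - simpl INR; rewrite !Rmult_1_l; exact H.
  - assert (Hp : 0 < INR N) by (apply lt_0_INR; lia).
    specialize (IH ltac:(lia)); intros x y.
    destruct (IH x y) as [S1 (R1 & N1 & C1)].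
    destruct (H (x + INR N * dx) (y + INR N * dy)) as [S2 (R2 & N2 & C2)].
    exists (fun x y t => S1 x y t \/ S2 x y t); rewrite !S_INR; split; [|split].
    + replace (x + (INR N + 1) * dx) with (x + INR N * dx + dx) by ring.
      replace (y + (INR N + 1) * dy) with (y + INR N * dy + dy) by ring.
      exact (reach_trans _ _ _ _ _ _ _ _ _ _ _ R1 R2).
    + intros x' y' th [HS|HS].
      * destruct (N1 _ _ _ HS) as (s & Hs & Hx & Hy).
        exists (s * INR N / (INR N + 1)); split.
        { split; [apply Rdiv_le_0_compat; nra|apply Rle_div_l; nra]. }
        replace (s * INR N / (INR N + 1) * ((INR N + 1) * dx))
          with (s * (INR N * dx)) by (field; lra).
        replace (s * INR N / (INR N + 1) * ((INR N + 1) * dy))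
          with (s * (INR N * dy)) by (field; lra).
        auto.
      * destruct (N2 _ _ _ HS) as (s & Hs & Hx & Hy).
        exists ((INR N + s) / (INR N + 1)); split.
        { split; [apply Rdiv_le_0_compat; lra|apply Rle_div_l; lra]. }
        replace (x + (INR N + s) / (INR N + 1) * ((INR N + 1) * dx))
          with (x + INR N * dx + s * dx) by (field; lra).
        replace (y + (INR N + s) / (INR N + 1) * ((INR N + 1) * dy))
          with (y + INR N * dy + s * dy) by (field; lra).
        auto.
    + rewrite Rmult_plus_distr_r, Rmult_1_l; now apply cover_touched_or.
Qed.

(** * Elementary moves and the cost per unit length *)

(** All touched points lie on one circle, a curve of measure zero. *)
Lemma cover_rotation L x y a b U eps :
  0 < L -> 0 < eps ->
  cover (touched L (fun x' y' th => x' = x /\ y' = y /\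
           exists s, 0 <= s <= 1 /\ th = a + s * b) U) eps.
Proof.
  intros HL He.
  (* The touched angles lie between [a - Rabs b] and [a + Rabs b + L]. *)
  set (W := 2 * Rabs b + L).
  assert (Hb : 0 <= Rabs b) by apply Rabs_pos.
  assert (HW : 0 < W) by (unfold W; lra).
  destruct (exists_nat_pos_ge (4 * W ^ 2 / eps)) as [m [Hm Hm1]].
  assert (Hm' : 0 < INR m) by (apply lt_0_INR; lia).
  eapply cover_sub; [| |apply (cover_curve (fun u => x + cos u) (fun u => y + sin u)
     (a - Rabs b) (a - Rabs b + W) 0 m)]; try lra; try lia.
  - intros p (x' & y' & th & u & (-> & -> & s & Hs & ->) & Hu & _ & ->).
    exists u; simpl.
    pose proof (Rabs_scaled_le s b (Rabs b) Hs (Rle_refl _)).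
    split; [unfold W; lra|].
    rewrite !Rminus_diag, Rabs_R0; lra.
  - replace (INR m * _) with (4 * W ^ 2 / INR m) by (field; lra).
    apply Rle_div_l; [lra|]. apply Rle_div_l in Hm1; lra.
  - intros u v; replace (_ - _) with (cos u - cos v) by ring; apply cos_lip1.
  - intros u v; replace (_ - _) with (sin u - sin v) by ring; apply sin_lip1.
Qed.

Lemma reach_rotation x y a b :
  reach x y a x y (a + b)
    (fun x' y' th => x' = x /\ y' = y /\ exists s, 0 <= s <= 1 /\ th = a + s * b).
Proof.
  pose proof (reach_line x y a 0 0 b
    (fun x' y' th => x' = x /\ y' = y /\ exists s, 0 <= s <= 1 /\ th = a + s * b)) as H.
  rewrite !Rplus_0_r in H; apply H.
  intros s Hs; repeat split; try ring; exists s; auto.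
Qed.

(** The arc is turned to start at [th], translated without turning, and turned back. During the
    translation it has no angle in [U], so only the two rotations count, for [m / 2] each. *)
Lemma move_translate L (U : R -> Prop) th dx dy eps m :
  0 < L -> (forall u, th <= u <= th + L -> ~ U u) -> 0 < eps -> 0 < m ->
  move L U dx dy eps m.
Proof.
  intros HL HU He Hm x y.
  pose proof (reach_rotation x y 0 th) as R1.
  pose proof (reach_rotation (x + dx) (y + dy) (0 + th) (- th)) as R3.
  pose proof (reach_line x y (0 + th) dx dy 0
    (fun x' y' t => t = th /\ exists s, 0 <= s <= 1 /\ x' = x + s * dx /\ y' = y + s * dy)) as R2.
  rewrite (Rplus_0_r (0 + th)) in R2.
  specialize (R2 ltac:(intros s Hs; split; [ring|]; exists s; auto)).
  pose proof (reach_trans _ _ _ _ _ _ _ _ _ _ _ R1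
                (reach_trans _ _ _ _ _ _ _ _ _ _ _ R2 R3)) as RR.
  replace (0 + th + - th) with 0 in RR by ring.
  eexists; split; [exact RR|split].
  - intros x' y' t [(-> & -> & _)|[(_ & s & Hs & -> & ->)|(-> & -> & _)]].
    + exists 0; split; [lra|]; split; apply Rabs_le; lra.
    + exists s; split; [lra|]; split; apply Rabs_le; lra.
    + exists 1; split; [lra|]; split; apply Rabs_le; lra.
  - replace m with (m / 2 + (0 + m / 2)) by field.
    apply cover_touched_or; [apply cover_rotation; lra|].
    apply cover_touched_or; [|apply cover_rotation; lra].
    apply cover_empty; intros p (x' & y' & t & u & [-> _] & Hu & HUu & _).
    exact (HU u Hu HUu).
Qed.

(** The angles in [V] are paid for using only that the centre stays near the segment, however the
    arc is turned on the way. *)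
Lemma move_add_angles L (U V W : R -> Prop) dx dy eps m m' :
  (forall u, W u -> U u \/ V u) ->
  (forall cx cy, cover (fun p => exists x y s u, 0 <= s <= 1 /\
      Rabs (x - (cx + s * dx)) <= eps /\ Rabs (y - (cy + s * dy)) <= eps /\
      V u /\ p = (x + cos u, y + sin u)) m') ->
  move L U dx dy eps m -> move L W dx dy eps (m + m').
Proof.
  intros HW HV H x y; destruct (H x y) as [S (HR & HN & HC)].
  exists S; split; [exact HR|split; [exact HN|]].
  eapply cover_sub; [|apply Rle_refl|exact (cover_union _ _ _ _ HC (HV x y))].
  intros p (x' & y' & th & u & HS & Hu & HWu & ->).
  destruct (HW u HWu) as [HUu|HVu]; [left|right].
  - exists x', y', th, u; auto.
  - destruct (HN _ _ _ HS) as (s & Hs & H1 & H2).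
    exists x', y', s, u; auto.
Qed.

(** [eps] is both the tolerance around the segment and an additive slack in the area. *)
Definition translation_cost (L kappa : R) : Prop :=
  forall phi rho eps, 0 < rho <= 1 -> 0 < eps ->
    move L (fun _ => True) (rho * cos phi) (rho * sin phi) eps (kappa * rho + eps).

(** The direct translation stays within [rho] of the fixed arc, which is contained in the angles
    from [0] to [2]. The squares have area at most [16 * rho ^ 2] each, in total
    [16 * rho * (2 + rho) <= 48 * rho]. *)
Lemma translation_cost_48 L : 0 < L <= 2 -> translation_cost L 48.
Proof.
  intros HL phi rho eps Hr He x y.
  pose proof (reach_line x y 0 (rho * cos phi) (rho * sin phi) 0
    (fun x' y' t => t = 0 /\ exists s, 0 <= s <= 1 /\
       x' = x + s * (rho * cos phi) /\ y' = y + s * (rho * sin phi))) as R2.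
  rewrite (Rplus_0_r 0) in R2.
  specialize (R2 ltac:(intros s Hs; split; [ring|]; exists s; auto)).
  eexists; split; [exact R2|split].
  - intros x' y' t (_ & s & Hs & -> & ->).
    exists s; split; [lra|]; split; apply Rabs_le; lra.
  - destruct (exists_nat_ceil (2 / rho)) as [m [Hm [Hm1 Hm2]]];
      [apply Rdiv_le_0_compat; lra|].
    assert (Hm' : 0 < INR m) by (apply lt_0_INR; lia).
    apply Rle_div_l in Hm1; [|lra].
    apply (Rmult_le_compat_r rho) in Hm2; [|lra].
    replace ((2 / rho + 1) * rho) with (2 + rho) in Hm2 by (field; lra).
    eapply cover_sub; [| |apply (cover_curve (fun u => x + cos u) (fun u => y + sin u)
       0 2 rho m)]; try lra; try lia.
    + intros p (x' & y' & th & u & (-> & s & Hs & -> & ->) & Hu & _ & ->).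
      exists u; simpl; split; [lra|].
      assert (Hrb : forall c, -1 <= c <= 1 -> Rabs (rho * c) <= rho)
        by (intros c Hc; rewrite Rmult_comm; apply Rabs_le_mult_bound; [exact Hc|];
            apply Rabs_le; lra).
      pose proof (Rabs_scaled_le s _ rho Hs (Hrb _ (COS_bound phi))).
      pose proof (Rabs_scaled_le s _ rho Hs (Hrb _ (SIN_bound phi))).
      split; apply Rabs_le; lra.
    + set (q := (2 - 0) / INR m).
      assert (Hq : 0 <= q <= rho).
      { unfold q; split; [apply Rdiv_le_0_compat; lra|].
        apply Rle_div_l; lra. }
      assert (INR m * (4 * (rho + q) ^ 2) <= INR m * (16 * rho ^ 2)).
      { apply Rmult_le_compat_l; [lra|]; nra. }
      nra.
    + intros u v; replace (_ - _) with (cos u - cos v) by ring; apply cos_lip1.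
    + intros u v; replace (_ - _) with (sin u - sin v) by ring; apply sin_lip1.
Qed.

(** * Splitting a displacement into perpendicular zigzags *)

Lemma cos_3_2_pos b : 0 <= b <= 3 / 2 -> 0 < cos b.
Proof. intros Hb; pose proof PI2_3_2; apply cos_gt_0; lra. Qed.

Lemma tan_le_3_2 b b' : 0 <= b -> b <= b' -> b' <= 3 / 2 -> tan b <= tan b'.
Proof.
  intros H0 H1 H2; pose proof PI2_3_2.
  destruct (Rle_lt_or_eq_dec _ _ H1) as [H3| ->]; [|lra].
  left; apply tan_increasing; lra.
Qed.

(** A unit step in direction [Om] followed by a step [tan b] in direction [Om - PI / 2] has
    direction [Om - b] and length [/ cos b]. This is the first coordinate, [sin_minus_div] the
    second. *)
Lemma cos_minus_div Om b :
  0 < cos b -> cos Om + tan b * sin Om = cos (Om - b) / cos b.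
Proof. intros H; rewrite cos_minus; unfold tan; field; lra. Qed.

Lemma sin_minus_div Om b :
  0 < cos b -> sin Om - tan b * cos Om = sin (Om - b) / cos b.
Proof. intros H; rewrite sin_minus; unfold tan; field; lra. Qed.

Lemma cos_minus_PI2 x : cos (x - PI / 2) = sin x.
Proof. rewrite cos_minus, cos_PI2, sin_PI2; ring. Qed.

Lemma sin_minus_PI2 x : sin (x - PI / 2) = - cos x.
Proof. rewrite sin_minus, cos_PI2, sin_PI2; ring. Qed.

(* In the step from [j] to [j + 1] the displacement, whose direction is
   [Om - (j + 1) d], is split into many small zigzags made of the previous
   displacement and of one in the fixed direction [Om - PI / 2].  All of these
   stay close to the new segment, to which the arc points with angle between
   [Om - (j + 1) d + PI / 2] and [Om - j d + PI / 2] are almost tangent; these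
   points, not counted so far, therefore add only an area [O(d ^ 2)]. *)
Lemma zigzag L kappa Om n j :
  0 < L < 3 / 2 -> translation_cost L kappa -> (2 <= n)%nat -> (j <= n)%nat ->
  let d := 3 / 2 / INR n in
  forall lam eps, 0 < lam <= cos (3 / 2) -> 0 < eps ->
  move L (fun u => u < Om - 3 / 2 + PI / 2 \/ Om - INR j * d + PI / 2 <= u)
    (lam * (cos Om + tan (INR j * d) * sin Om))
    (lam * (sin Om - tan (INR j * d) * cos Om)) eps
    (lam * (INR j * (384 * d ^ 2 / cos (3 / 2)) + kappa * tan (INR j * d)) + eps).
Proof.
  intros HL HP Hn Hj d.
  assert (Hn' : 2 <= INR n) by (apply (le_INR 2); exact Hn).
  assert (Hd : 0 < d <= 1).
  { unfold d; split; [apply Rdiv_lt_0_compat; lra|apply Rle_div_l; lra]. }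
  assert (Hnd : INR n * d = 3 / 2) by (unfold d; field; lra).
  assert (Hq : 0 < cos (3 / 2)) by (apply cos_3_2_pos; lra).
  clearbody d.
  induction j as [|j IH]; intros lam eps Hlam He.
  - simpl INR; rewrite !Rmult_0_l.
    (* The uncounted gap of angles has length [3 / 2], so the arc of length [L < 3 / 2] fits inside
       it. *)
    apply (move_translate L _ (Om - 3 / 2 + PI / 2)); [lra| |lra|].
    + intros u Hu [H|H]; lra.
    + rewrite tan_0; lra.
  - specialize (IH ltac:(lia)).
    set (b := INR j * d) in *; set (b' := INR (S j) * d).
    assert (Hbb : b' = b + d) by (unfold b, b'; rewrite S_INR; ring).
    assert (Hb0 : 0 <= b) by (apply Rmult_le_pos; [apply pos_INR|lra]).
    assert (Hb' : b' <= 3 / 2).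
    { rewrite <- Hnd; apply Rmult_le_compat_r; [lra|]; now apply le_INR. }
    assert (Hc' : 0 < cos b') by (apply cos_3_2_pos; lra).
    assert (Hcq : cos (3 / 2) <= cos b').
    { pose proof PI2_3_2; apply cos_decr_1; lra. }
    assert (T0 : 0 <= tan b) by (rewrite <- tan_0; apply tan_le_3_2; lra).
    assert (T1 : tan b < tan b') by (pose proof PI2_3_2; apply tan_increasing; lra).
    assert (T2 : tan b' <= tan (3 / 2)) by (apply tan_le_3_2; lra).
    assert (T3 : cos (3 / 2) * tan (3 / 2) <= 1).
    { unfold tan; replace (_ * _) with (sin (3 / 2)) by (field; lra).
      apply SIN_bound. }
    (* [mu * K] will bound the coordinates of both legs of one zigzag. *)
    set (K := 1 + tan (3 / 2)).
    destruct (cover_tube (lam / cos b') d) as (et & Het & Htube);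
      [apply Rdiv_lt_0_compat; lra|exact Hd|].
    (* Nearness [e] serves both the conclusion and the tube around the new segment. *)
    set (e := Rmin eps et).
    assert (Hepos : 0 < e) by (unfold e; apply Rmin_glb_lt; lra).
    assert (He1 : e <= eps) by apply Rmin_l.
    assert (He2 : e <= et) by apply Rmin_r.
    destruct (exists_nat_pos_ge (4 * lam * K / e)) as [N [HN HN1]].
    assert (HN' : 1 <= INR N) by (apply (le_INR 1); lia).
    set (mu := lam / INR N).
    assert (Hmu : INR N * mu = lam) by (unfold mu; field; lra).
    assert (Hmu0 : 0 < mu) by (apply Rdiv_lt_0_compat; lra).
    assert (Hmul : mu <= lam) by (apply Rle_div_l; nra).
    assert (HmuK : 4 * (mu * K) <= e).
    { unfold mu; replace (4 * (lam / INR N * K)) with (4 * lam * K / INR N) by (field; lra).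
      apply Rle_div_l; [lra|]; apply Rle_div_l in HN1; lra. }
    (* A zigzag stays within [f + 2 * (mu * K) <= e], and its two legs add a slack of [2 * f], which
       over [N] zigzags is at most [eps]. *)
    set (f := Rmin (e / 2) (eps / (2 * INR N))).
    assert (Hf0 : 0 < f) by (unfold f; apply Rmin_glb_lt; [lra|apply Rdiv_lt_0_compat; lra]).
    assert (Hf1 : f <= e / 2) by apply Rmin_l.
    assert (Hf2 : 2 * (INR N * f) <= eps).
    { assert (H : f <= eps / (2 * INR N)) by apply Rmin_r.
      apply (Rmult_le_compat_l (2 * INR N)) in H; [|lra].
      replace (2 * INR N * (eps / (2 * INR N))) with eps in H by (field; lra); lra. }
    pose proof (IH mu f ltac:(lra) Hf0) as M1.
    (* This leg raises the perpendicular component from [tan b] to [tan b']. Its length is at most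
       [1] because [mu <= cos (3 / 2)]. *)
    pose proof (HP (Om - PI / 2) (mu * (tan b' - tan b)) f
      ltac:(split; [apply Rmult_lt_0_compat; lra|nra]) Hf0) as M2.
    rewrite cos_minus_PI2, sin_minus_PI2 in M2.
    assert (Hbd : forall t s c, 0 <= t <= tan (3 / 2) -> -1 <= c <= 1 -> -1 <= s <= 1 ->
              Rabs (mu * (c + t * s)) <= mu * K).
    { intros t s c Ht Hc Hs; rewrite Rabs_mult, (Rabs_right mu) by lra.
      apply Rmult_le_compat_l; [lra|]; unfold K; apply Rabs_le.
      pose proof (Rabs_scaled_le 1 s 1 ltac:(lra) ltac:(apply Rabs_le; lra)).
      split; nra. }
    pose proof (COS_bound Om) as BC; pose proof (SIN_bound Om) as BS.
    assert (M : move L (fun u => u < Om - 3 / 2 + PI / 2 \/ Om - b + PI / 2 <= u)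
        (mu * (cos Om + tan b * sin Om) + mu * (tan b' - tan b) * sin Om)
        (mu * (sin Om - tan b * cos Om) + mu * (tan b' - tan b) * - cos Om)
        (f + 2 * (mu * K))
        (mu * (INR j * (384 * d ^ 2 / cos (3 / 2)) + kappa * tan b) + f
          + (kappa * (mu * (tan b' - tan b)) + f))).
    { apply move_seq; [| | | |exact M1|].
      - apply Hbd; lra.
      - replace (sin Om - tan b * cos Om) with (sin Om + tan b * - cos Om) by ring.
        apply Hbd; lra.
      - replace (mu * (tan b' - tan b) * sin Om)
          with (mu * (0 + (tan b' - tan b) * sin Om)) by ring.
        apply Hbd; lra.
      - replace (mu * (tan b' - tan b) * - cos Om)
          with (mu * (0 + (tan b' - tan b) * - cos Om)) by ring.
        apply Hbd; lra.
      - refine (move_weaken _ _ _ _ _ _ _ _ _ _ _ _ M2); [intros; exact I|lra|lra]. }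
    apply (move_iter _ _ _ _ _ _ N HN) in M.
    replace (INR N * (mu * (cos Om + tan b * sin Om) + mu * (tan b' - tan b) * sin Om))
      with (lam * (cos Om + tan b' * sin Om)) in M by (rewrite <- Hmu; ring).
    replace (INR N * (mu * (sin Om - tan b * cos Om) + mu * (tan b' - tan b) * - cos Om))
      with (lam * (sin Om - tan b' * cos Om)) in M by (rewrite <- Hmu; ring).
    apply (move_weaken _ _ (fun u => u < Om - 3 / 2 + PI / 2 \/ Om - b + PI / 2 <= u)
             _ _ _ e _ (lam * (INR j * (384 * d ^ 2 / cos (3 / 2)) + kappa * tan b') + eps))
      in M; [|auto|lra|].
    2: { rewrite <- Hmu at 1.
         replace (INR N * _) with
           (INR N * mu * (INR j * (384 * d ^ 2 / cos (3 / 2)) + kappa * tan b')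
             + 2 * (INR N * f)) by ring.
         rewrite Hmu; lra. }
    (* Since [b' = b + d], the new angles end exactly where those counted so far begin again. *)
    apply (move_add_angles _ _
      (fun u => Om - b' + PI / 2 <= u <= Om - b' + PI / 2 + d)
      (fun u => u < Om - 3 / 2 + PI / 2 \/ Om - b' + PI / 2 <= u)
      _ _ _ _ (384 * (lam / cos b' * d ^ 2))) in M.
    + eapply move_weaken; [| | |exact M]; [auto|lra|].
      rewrite S_INR.
      assert (384 * (lam / cos b' * d ^ 2) <= lam * (384 * d ^ 2 / cos (3 / 2))).
      { replace (384 * (lam / cos b' * d ^ 2)) with (lam * (384 * d ^ 2) * / cos b')
          by (field; lra).
        replace (lam * (384 * d ^ 2 / cos (3 / 2)))
          with (lam * (384 * d ^ 2) * / cos (3 / 2)) by (field; lra).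
        apply Rmult_le_compat_l.
        - apply Rmult_le_pos; [lra|]; nra.
        - apply Rinv_le_contravar; lra. }
      lra.
    + intros u [H|H]; [now left; left|].
      destruct (Rle_lt_dec (Om - b + PI / 2) u); [left; right; lra|right; lra].
    + intros cx cy; eapply cover_sub; [|apply Rle_refl|exact (Htube cx cy (Om - b'))].
      intros p (x & y & s & u & Hs & Hx & Hy & Hu & Hp).
      exists x, y, s, u; split; [exact Hs|].
      rewrite cos_minus_div in Hx by exact Hc'.
      rewrite sin_minus_div in Hy by exact Hc'.
      replace (lam / cos b' * cos (Om - b')) with (lam * (cos (Om - b') / cos b'))
        by (field; lra).
      replace (lam / cos b' * sin (Om - b')) with (lam * (sin (Om - b') / cos b'))
        by (field; lra).
      repeat split; try exact Hp; lra.
Qed.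

(** * Contraction of the cost and arbitrary displacements *)

(** After all [n] stages the direction is [Om - 3 / 2 = phi] and the gap of uncounted angles has
    closed. With [lam = rho * cos (3 / 2)] the tubes cost [864 * rho / INR n] and the perpendicular
    legs [kappa * sin (3 / 2) * rho]. *)
Lemma translation_cost_contract L kappa :
  0 < L < 3 / 2 -> translation_cost L kappa ->
  translation_cost L (kappa * sin (3 / 2)).
Proof.
  intros HL HP phi rho eps Hr He.
  assert (Hq : 0 < cos (3 / 2)) by (apply cos_3_2_pos; lra).
  destruct (exists_nat_pos_ge (Rmax 2 (1728 * rho / eps))) as [n [Hn Hn1]].
  pose proof (Rmax_l 2 (1728 * rho / eps)); pose proof (Rmax_r 2 (1728 * rho / eps)).
  assert (Hn2 : (2 <= n)%nat) by (apply INR_le; simpl; lra).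
  assert (Hcos : cos (3 / 2) <= 1) by apply COS_bound.
  pose proof (zigzag L kappa (phi + 3 / 2) n n HL HP Hn2 (le_n n)
    (rho * cos (3 / 2)) (eps / 2)
    ltac:(split; [apply Rmult_lt_0_compat; lra|nra]) ltac:(lra)) as M.
  cbv zeta in M.
  replace (INR n * (3 / 2 / INR n)) with (3 / 2) in M by (field; lra).
  rewrite cos_minus_div, sin_minus_div in M by exact Hq.
  replace (phi + 3 / 2 - 3 / 2) with phi in M by ring.
  replace (rho * cos (3 / 2) * (cos phi / cos (3 / 2))) with (rho * cos phi) in M
    by (field; lra).
  replace (rho * cos (3 / 2) * (sin phi / cos (3 / 2))) with (rho * sin phi) in M
    by (field; lra).
  eapply move_weaken; [| | |exact M].
  - intros u _; destruct (Rle_lt_dec (phi + PI / 2) u); [right|left]; lra.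
  - lra.
  - replace (rho * cos (3 / 2) * _) with
      (864 * rho / INR n + kappa * sin (3 / 2) * rho).
    2: { unfold tan; field; lra. }
    assert (864 * rho / INR n <= eps / 2).
    { apply Rle_div_l; [lra|].
      assert (Hx : 1728 * rho / eps <= INR n) by lra.
      apply Rle_div_l in Hx; lra. }
    lra.
Qed.

Lemma translation_cost_small L eps :
  0 < L < 3 / 2 -> 0 < eps -> exists kappa, 0 <= kappa < eps /\ translation_cost L kappa.
Proof.
  intros HL He.
  assert (Hs : 0 < sin (3 / 2) < 1).
  { pose proof PI2_3_2; split; [apply sin_gt_0; lra|].
    rewrite <- sin_PI2; apply sin_increasing_1; lra. }
  assert (H : forall k, translation_cost L (48 * sin (3 / 2) ^ k)).
  { induction k as [|k IH].
    - simpl; rewrite Rmult_1_r; apply translation_cost_48; lra.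
    - replace (48 * sin (3 / 2) ^ S k) with (48 * sin (3 / 2) ^ k * sin (3 / 2))
        by (simpl; ring).
      now apply translation_cost_contract. }
  destruct (pow_lt_1_zero (sin (3 / 2))
    ltac:(rewrite Rabs_right; lra) (eps / 48) ltac:(lra)) as [k Hk].
  specialize (Hk k (le_n k)).
  exists (48 * sin (3 / 2) ^ k); split; [|apply H].
  pose proof (pow_lt (sin (3 / 2)) k ltac:(lra)).
  rewrite Rabs_right in Hk; lra.
Qed.

Lemma unit_vector_angle x y : x ^ 2 + y ^ 2 = 1 -> exists phi, x = cos phi /\ y = sin phi.
Proof.
  intros H.
  assert (Hx : -1 <= x <= 1) by nra.
  assert (Hs : sqrt (1 - Rsqr x) = Rabs y).
  { rewrite <- sqrt_Rsqr_abs; f_equal; unfold Rsqr; nra. }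
  destruct (Rle_lt_dec 0 y) as [Hy|Hy].
  - exists (acos x); rewrite cos_acos, sin_acos, Hs, Rabs_right by lra; auto.
  - exists (- acos x); rewrite cos_neg, sin_neg, cos_acos, sin_acos, Hs, Rabs_left by lra.
    split; [reflexivity|ring].
Qed.

Lemma polar_coordinates x y :
  exists r phi, 0 <= r /\ x = r * cos phi /\ y = r * sin phi.
Proof.
  set (r := sqrt (x ^ 2 + y ^ 2)).
  assert (Hp : 0 <= x ^ 2 + y ^ 2) by nra.
  assert (Hr : 0 <= r) by apply sqrt_pos.
  assert (Hr2 : r * r = x ^ 2 + y ^ 2) by (now apply sqrt_sqrt).
  clearbody r.
  destruct (Rle_lt_or_eq_dec _ _ Hr) as [Hr0|<-].
  - destruct (unit_vector_angle (x / r) (y / r)) as (phi & Hx & Hy).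
    { replace (_ + _) with ((x ^ 2 + y ^ 2) / (r * r)) by (field; lra).
      rewrite <- Hr2; field; lra. }
    exists r, phi; rewrite <- Hx, <- Hy; split; [exact Hr|split; field; lra].
  - exists 0, 0; split; [lra|]; nra.
Qed.

Lemma reach_any L x y t x' y' t' eps :
  0 < L < 3 / 2 -> 0 < eps ->
  exists S, reach x y t x' y' t' S /\ cover (touched L S (fun _ => True)) eps.
Proof.
  intros HL He.
  pose proof (reach_rotation x y t (- t)) as R1.
  pose proof (reach_rotation x' y' 0 t') as R3.
  rewrite Rplus_opp_r in R1; rewrite Rplus_0_l in R3.
  assert (HM : exists S, reach x y 0 x' y' 0 S /\
             cover (touched L S (fun _ => True)) (eps / 2)).
  { destruct (polar_coordinates (x' - x) (y' - y)) as (r & phi & Hr & Hx & Hy).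
    destruct (Rle_lt_or_eq_dec _ _ Hr) as [Hr0|Hr0].
    - destruct (translation_cost_small L (eps / 4 / r)) as (kappa & Hk & HP);
        [exact HL|apply Rdiv_lt_0_compat; lra|].
      destruct (exists_nat_pos_ge r) as [N [HN HN1]].
      assert (HN' : 0 < INR N) by (apply lt_0_INR; lia).
      assert (Hf : 0 < eps / 4 / INR N) by (apply Rdiv_lt_0_compat; lra).
      pose proof (HP phi (r / INR N) (eps / 4 / INR N)
        ltac:(split; [apply Rdiv_lt_0_compat; lra|apply Rle_div_l; lra]) Hf) as M.
      apply (move_iter _ _ _ _ _ _ N HN) in M.
      destruct (M x y) as (S & HR & _ & HC).
      exists S; split.
      + replace x' with (x + INR N * (r / INR N * cos phi)).
        2: { replace (INR N * _) with (r * cos phi) by (field; lra); lra. }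
        replace y' with (y + INR N * (r / INR N * sin phi)).
        2: { replace (INR N * _) with (r * sin phi) by (field; lra); lra. }
        exact HR.
      + eapply cover_sub; [| |exact HC]; [auto|].
        replace (INR N * _) with (kappa * r + eps / 4) by (field; lra).
        assert (kappa * r <= eps / 4) by (apply Rle_div_r; lra).
        lra.
    - subst r; rewrite !Rmult_0_l in *.
      replace x' with x by lra; replace y' with y by lra.
      pose proof (reach_rotation x y 0 0) as R2; rewrite Rplus_0_r in R2.
      eexists; split; [exact R2|]; apply cover_rotation; lra. }
  destruct HM as (S & R2 & C2).
  eexists; split; [exact (reach_trans _ _ _ _ _ _ _ _ _ _ _ R1
                (reach_trans _ _ _ _ _ _ _ _ _ _ _ R2 R3))|].
  replace eps with (eps / 4 + (eps / 2 + eps / 4)) by field.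
  apply cover_touched_or; [apply cover_rotation; lra|].
  apply cover_touched_or; [exact C2|apply cover_rotation; lra].
Qed.

(** * Isometries of the plane and their action on arcs *)

Lemma dist2_eq_sqr p q p' q' :
  dist2 p q = dist2 p' q' ->
  (fst p - fst q) ^ 2 + (snd p - snd q) ^ 2 = (fst p' - fst q') ^ 2 + (snd p' - snd q') ^ 2.
Proof. intros H; apply sqrt_inj; [| |exact H]; apply Rplus_le_le_0_compat; apply pow2_ge_0. Qed.

(** The images of the origin and of the two basis vectors determine the map, since a point is fixed
    by its distances to these three. The sign [k] is the determinant. *)
Lemma isometry_form f :
  isometry f -> exists x0 y0 beta k, (k = 1 \/ k = -1) /\
    forall x y, f (x, y) = (x0 + x * cos beta - k * (y * sin beta),
                            y0 + x * sin beta + k * (y * cos beta)).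
Proof.
  intros Hf.
  assert (Hd : forall p q, (fst (f p) - fst (f q)) ^ 2 + (snd (f p) - snd (f q)) ^ 2
      = (fst p - fst q) ^ 2 + (snd p - snd q) ^ 2)
    by (intros p q; apply dist2_eq_sqr, Hf).
  destruct (f (0, 0)) as [x0 y0] eqn:EO.
  destruct (f (1, 0)) as [a1 a2] eqn:EA.
  destruct (f (0, 1)) as [b1 b2] eqn:EB.
  pose proof (Hd (1, 0) (0, 0)) as HA; rewrite EO, EA in HA; simpl fst in HA; simpl snd in HA.
  pose proof (Hd (0, 1) (0, 0)) as HB; rewrite EO, EB in HB; simpl fst in HB; simpl snd in HB.
  pose proof (Hd (1, 0) (0, 1)) as HAB; rewrite EA, EB in HAB; simpl fst in HAB; simpl snd in HAB.
  destruct (unit_vector_angle (a1 - x0) (a2 - y0)) as (beta & Hc & Hs); [lra|].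
  assert (Ea1 : a1 = x0 + cos beta) by lra.
  assert (Ea2 : a2 = y0 + sin beta) by lra.
  set (u1 := b1 - x0) in *; set (u2 := b2 - y0) in *.
  assert (Eb1 : b1 = x0 + u1) by (unfold u1; ring).
  assert (Eb2 : b2 = y0 + u2) by (unfold u2; ring).
  clearbody u1 u2; subst a1 a2 b1 b2.
  assert (H1 : cos beta * cos beta + sin beta * sin beta = 1)
    by (pose proof (sin2_cos2 beta); unfold Rsqr in *; lra).
  assert (H2 : u1 * u1 + u2 * u2 = 1) by lra.
  assert (H3 : u1 * cos beta + u2 * sin beta = 0) by nra.
  set (k := u2 * cos beta - u1 * sin beta).
  assert (Hk1 : u1 = - k * sin beta).
  { unfold k; transitivity (u1 * (cos beta * cos beta + sin beta * sin beta)
      - cos beta * (u1 * cos beta + u2 * sin beta)); [rewrite H1, H3; ring|ring]. }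
  assert (Hk2 : u2 = k * cos beta).
  { unfold k; transitivity (u2 * (cos beta * cos beta + sin beta * sin beta)
      - sin beta * (u1 * cos beta + u2 * sin beta)); [rewrite H1, H3; ring|ring]. }
  clearbody k; subst u1 u2.
  assert (Hkk : k * k = 1).
  { transitivity (k * k * (cos beta * cos beta + sin beta * sin beta)); [rewrite H1; ring|lra]. }
  exists x0, y0, beta, k; split.
  { assert (HH : (k - 1) * (k + 1) = 0) by lra.
    apply Rmult_integral in HH; destruct HH; [left|right]; lra. }
  intros x y.
  pose proof (Hd (x, y) (0, 0)) as P0; rewrite EO in P0.
  pose proof (Hd (x, y) (1, 0)) as P1; rewrite EA in P1.
  pose proof (Hd (x, y) (0, 1)) as P2; rewrite EB in P2.
  destruct (f (x, y)) as [p q]; simpl fst in *; simpl snd in *.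
  set (v1 := p - x0) in *; set (v2 := q - y0) in *.
  assert (Ep : p = x0 + v1) by (unfold v1; ring).
  assert (Eq : q = y0 + v2) by (unfold v2; ring).
  clearbody v1 v2; subst p q.
  (* Subtracting squared distances to two base points leaves linear equations. *)
  assert (Q1 : v1 * cos beta + v2 * sin beta = x) by nra.
  assert (Q2 : k * (v2 * cos beta - v1 * sin beta) = y).
  { assert (2 * (k * (v2 * cos beta - v1 * sin beta)) = 2 * y
      - 1 + k * k * (cos beta * cos beta + sin beta * sin beta)) by nra.
    rewrite H1, Hkk in *; lra. }
  assert (Q3 : v2 * cos beta - v1 * sin beta = k * y).
  { rewrite <- Q2, <- Rmult_assoc, Hkk; ring. }
  f_equal.
  - enough (v1 = x * cos beta - k * y * sin beta) by lra.
    rewrite <- Q1, <- Q3.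
    transitivity (v1 * (cos beta * cos beta + sin beta * sin beta)); [rewrite H1|]; ring.
  - enough (v2 = x * sin beta + k * y * cos beta) by lra.
    rewrite <- Q1, <- Q3.
    transitivity (v2 * (cos beta * cos beta + sin beta * sin beta)); [rewrite H1|]; ring.
Qed.

(** A circular arc has a mirror symmetry, so even a reflected copy is an arc given by a centre and a
    starting angle, within reach of rigid motions. *)
Lemma image_unit_arc f cx cy alpha L :
  isometry f -> exists x y t, forall p,
    image f (unit_arc cx cy alpha L) p <-> unit_arc x y t L p.
Proof.
  intros Hf; destruct (isometry_form f Hf) as (x0 & y0 & beta & k & Hk & Ff).
  exists (fst (f (cx, cy))), (snd (f (cx, cy))).
  destruct Hk as [-> | ->].
  - exists (beta + alpha); intros p; split.
    + intros (q & (u & Hu & ->) & <-); exists (beta + u); split; [lra|].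
      rewrite !Ff, cos_plus, sin_plus; simpl; f_equal; ring.
    + intros (v & Hv & ->); exists (cx + cos (v - beta), cy + sin (v - beta)); split.
      * exists (v - beta); split; [lra|reflexivity].
      * assert (Ev : v = beta + (v - beta)) by ring.
        set (w := v - beta) in *; clearbody w; subst v.
        rewrite !Ff, cos_plus, sin_plus; simpl; f_equal; ring.
  (* A reflection reverses the angles, so the image starts at the image of the old endpoint
     [alpha + L]. *)
  - exists (beta - alpha - L); intros p; split.
    + intros (q & (u & Hu & ->) & <-); exists (beta - u); split; [lra|].
      rewrite !Ff, cos_minus, sin_minus; simpl; f_equal; ring.
    + intros (v & Hv & ->); exists (cx + cos (beta - v), cy + sin (beta - v)); split.
      * exists (beta - v); split; [lra|reflexivity].
      * assert (Ev : v = beta - (beta - v)) by ring.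
        set (w := beta - v) in *; clearbody w; subst v.
        rewrite !Ff, cos_minus, sin_minus; simpl; f_equal; ring.
Qed.

(** * From paths of states to continuous motions *)

Lemma continuity_continuous_on_01 f : continuity f -> continuous_on_01 f.
Proof.
  intros Hf t _ eps He; destruct (Hf t eps He) as (delta & Hd & H).
  exists delta; split; [exact Hd|]; intros t' _ Ht.
  destruct (Req_dec t' t) as [->|Hn].
  - rewrite Rminus_diag, Rabs_R0; exact He.
  - apply H; split; [split; [exact I|auto]|exact Ht].
Qed.

Section MotionOfPath.

Variables (cx cy alpha L : R) (fx fy ft : R -> R).
Hypotheses (Cx : continuity fx) (Cy : continuity fy) (Ct : continuity ft).

Let rc (t : R) : R := cos (ft t - alpha).
Let rs (t : R) : R := sin (ft t - alpha).

Lemma continuity_path_rotation : continuity rc /\ continuity rs.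
Proof.
  assert (C : continuity (fun t => ft t - alpha)).
  { apply (continuity_minus ft (fun _ => alpha) Ct).
    apply continuity_const; intros ? ?; reflexivity. }
  split.
  - exact (continuity_comp _ _ C continuity_cos).
  - exact (continuity_comp _ _ C continuity_sin).
Qed.

Lemma path_rotation_unit t : 0 <= t <= 1 -> rc t ^ 2 + rs t ^ 2 = 1.
Proof.
  intros _; pose proof (sin2_cos2 (ft t - alpha)); unfold rc, rs, Rsqr in *; lra.
Qed.

(** The translation part is chosen so that [(cx, cy)] is sent to [(fx t, fy t)]. *)
Let ra (t : R) : R := fx t - (rc t * cx - rs t * cy).
Let rb (t : R) : R := fy t - (rs t * cx + rc t * cy).

Lemma continuity_path_translation : continuity ra /\ continuity rb.
Proof.
  destruct continuity_path_rotation as [C S].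
  assert (K : forall c, continuity (fun _ : R => c))
    by (intros c; apply continuity_const; intros ? ?; reflexivity).
  split.
  - exact (continuity_minus _ _ Cx (continuity_minus _ _
      (continuity_mult _ _ C (K cx)) (continuity_mult _ _ S (K cy)))).
  - exact (continuity_minus _ _ Cy (continuity_plus _ _
      (continuity_mult _ _ S (K cx)) (continuity_mult _ _ C (K cy)))).
Qed.

Definition path_motion : motion :=
  Motion rc rs ra rb path_rotation_unit
    (continuity_continuous_on_01 _ (proj1 continuity_path_rotation))
    (continuity_continuous_on_01 _ (proj2 continuity_path_rotation))
    (continuity_continuous_on_01 _ (proj1 continuity_path_translation))
    (continuity_continuous_on_01 _ (proj2 continuity_path_translation)).

Lemma path_motion_point t u :
  mapp path_motion t (cx + cos u, cy + sin u) =
  (fx t + cos (ft t - alpha + u), fy t + sin (ft t - alpha + u)).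
Proof.
  unfold mapp, rigid, path_motion, ra, rb, rc, rs; cbn [mc ms ma mb fst snd].
  rewrite cos_plus, sin_plus; f_equal; ring.
Qed.

Lemma path_motion_image t p :
  image (mapp path_motion t) (unit_arc cx cy alpha L) p <->
  unit_arc (fx t) (fy t) (ft t) L p.
Proof.
  split.
  - intros (q & (u & Hu & ->) & <-).
    exists (ft t - alpha + u); split; [lra|apply path_motion_point].
  - intros (v & Hv & ->).
    exists (cx + cos (v - ft t + alpha), cy + sin (v - ft t + alpha)); split.
    + exists (v - ft t + alpha); split; [lra|reflexivity].
    + rewrite path_motion_point.
      replace (ft t - alpha + (v - ft t + alpha)) with v by ring; reflexivity.
Qed.

Lemma path_motion_start :
  fx 0 = cx -> fy 0 = cy -> ft 0 = alpha -> mapp path_motion 0 = (fun p => p).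
Proof.
  intros Hx Hy Ht; extensionality p; destruct p as [x y].
  unfold mapp, rigid, path_motion, ra, rb, rc, rs; cbn [mc ms ma mb fst snd].
  rewrite Hx, Hy, Ht, Rminus_diag, cos_0, sin_0; f_equal; ring.
Qed.

End MotionOfPath.

Theorem theorem1 :
  forall (cx cy alpha L : R), 0 < L -> L < 132 / 100 ->
  forall f : point -> point, isometry f ->
  forall eps : R, eps > 0 ->
  exists g : motion,
    mapp g 0 = (fun p => p) /\
    (forall p, image (mapp g 1) (unit_arc cx cy alpha L) p <->
               image f (unit_arc cx cy alpha L) p) /\
    measure_lt (swept g (unit_arc cx cy alpha L)) eps.
Proof.
  intros cx cy alpha L HL0 HL1 f Hf eps He.
  destruct (image_unit_arc f cx cy alpha L Hf) as (x' & y' & t' & Him).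
  (* Half of [eps] leaves room for the strict inequality in [measure_lt]. *)
  destruct (reach_any L cx cy alpha x' y' t' (eps / 2)) as (S & HR & HC); [lra|lra|].
  destruct HR as (fx & fy & ft & (Cx & Cy & Ct) & (X0 & Y0 & T0) & (X1 & Y1 & T1) & HS).
  exists (path_motion cx cy alpha fx fy ft Cx Cy Ct); split; [|split].
  - now apply path_motion_start.
  - intros p; rewrite path_motion_image, Him, X1, Y1, T1; reflexivity.
  - apply measure_lt_cover with (eps / 2); [|lra].
    eapply cover_sub; [|apply Rle_refl|exact HC].
    intros p (t & Ht & Hp); apply path_motion_image in Hp as (u & Hu & ->).
    exists (fx t), (fy t), (ft t), u; auto.
Qed.
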